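(* Let $(X_k^{(i)})_{k\ge1}$ and $(X_k^{(j)})_{k\ge1}$ be real-valued random sequences (trajectories) on a common probability space, with empirical measures $\hat\mu_n^{(r)}=\frac1n\sum_{k=1}^n\delta_{X_k^{(r)}}$, $r\in\{i,j\}$, and let $T_{ij,n}:=\sqrt n\,W_1(\hat\mu_n^{(i)},\hat\mu_n^{(j)})$. Let $\alpha\in(0,1)$ and let $q_{1-\alpha}^{(ij)}$ be the $(1-\alpha)$-quantile of $Z_{ij}:=\int_{\mathbb R}|G^{(i)}(t)-G^{(j)}(t)|\,dt$, with $G^{(i)},G^{(j)}$ as in the context (so $q_{1-\alpha}^{(ij)}$ is a fixed finite number not depending on $n$). Suppose that under $H_A:\mu^{(i)}\ne\mu^{(j)}$ there are probability measures $\mu^{(i)},\mu^{(j)}$ on $\mathbb R$ with $$W_1(\mu^{(i)},\mu^{(j)})>0,\qquad \hat\mu_n^{(i)}\to\mu^{(i)}\ \text{a.s.},\qquad \hat\mu_n^{(j)}\to\mu^{(j)}\ \text{a.s.}$$ (weak convergence of measures). Then the test rejecting $H_0:\mu^{(i)}=\mu^{(j)}$ whenever $T_{ij,n}>q_{1-\alpha}^{(ij)}$ is consistent: $$\mathbb P_{H_A}\bigl(T_{ij,n}>q_{1-\alpha}^{(ij)}\bigr)\to1\qquad(n\to\infty).$$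
   Context: $W_1$ is the 1-Wasserstein distance; on $\mathbb R$ it equals $W_1(\nu_1,\nu_2)=\int_{\mathbb R}|F_{\nu_1}(t)-F_{\nu_2}(t)|\,dt\in[0,\infty]$, where $F_\nu$ is the distribution function of $\nu$; $\delta_x$ is the Dirac measure at $x$. The $(1-\alpha)$-quantile of a real random variable $Z$ is $\inf\{x\in\mathbb R:\mathbb P(Z\le x)\ge1-\alpha\}$. $\mathbb P_{H_A}$ is probability under $H_A$. $G^{(i)},G^{(j)}$ are independent, identically distributed centered Gaussian random elements of $L^1(\mathbb R)$ (so $Z_{ij}<\infty$ a.s.), the limit processes under the null hypothesis: for a stationary reference sequence $(X^0_k)_{k\in\mathbb Z}$ with marginal distribution function $F$, and all bounded measurable $f,g:\mathbb R\to\mathbb R$, each satisfies $$\operatorname{Cov}\Bigl(\int f(t)G^{(r)}(t)\,dt,\int g(t)G^{(r)}(t)\,dt\Bigr)=\sum_{k\in\mathbb Z}\mathbb E\Bigl(\iint f(t)g(s)\bigl(\mathbf 1\{X^0_0\le t\}-F(t)\bigr)\bigl(\mathbf 1\{X^0_k\le s\}-F(s)\bigr)\,dt\,ds\Bigr).$$ *)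

(* Defs.v *)
From HB Require Import structures.
From mathcomp Require Import all_boot all_order all_algebra.
From mathcomp Require Import all_classical all_reals all_analysis.

Set Implicit Arguments.
Unset Strict Implicit.
Unset Printing Implicit Defensive.

Import Order.TTheory GRing.Theory Num.Theory.
Import numFieldNormedType.Exports.

Local Open Scope classical_set_scope.
Local Open Scope ring_scope.

Section wasserstein.
Context {R : realType}.
Let RR := measurableTypeR R.

Definition coupling (mu nu : {measure set RR -> \bar R})
    (pi : {measure set (RR * RR) -> \bar R}) :=
  forall A : set RR, measurable A ->
    pi (A `*` setT) = mu A /\ pi (setT `*` A) = nu A.

(* With values in [0, +oo]: no finite first moment is assumed. *)
Definition W1 (mu nu : {measure set RR -> \bar R}) : \bar R :=
  ereal_inf [set (\int[pi]_z `|z.1 - z.2|%:E)%E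
            | pi in [set pi | coupling mu nu pi]].

Definition weakly_cvg (m : nat -> {measure set RR -> \bar R})
    (m0 : {measure set RR -> \bar R}) :=
  forall f : R -> R, continuous f -> (exists M, forall x, `|f x| <= M) ->
    (\int[m n]_x (f x)%:E)%E @[n --> \oo] --> (\int[m0]_x (f x)%:E)%E.

End wasserstein.

Section empirical.
Context {R : realType} d (T : measurableType d) (P : probability T R).

(* Sequences are indexed from 0: [X k] is the (k+1)-st observation. *)
Definition empirical (X : nat -> {RV P >-> measurableTypeR R}) (n : nat)
    (w : T) : {measure set (measurableTypeR R) -> \bar R} :=
  mscale (n%:R^-1)%:nng (msum (fun k => \d_(X k w)) n).

Definition Tstat (X Y : nat -> {RV P >-> measurableTypeR R}) (n : nat)
    (w : T) : \bar R :=
  ((Num.sqrt n%:R)%:E * W1 (empirical X n w) (empirical Y n w))%E.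

(* [inf] of an empty or unbounded-below set of reals is 0; for an a.s. finite
   [Z >= 0] and 0 < p the set is nonempty and bounded below. *)
Definition quantile (Z : T -> \bar R) (p : R) : R :=
  inf [set x : R | (p%:E <= P [set w | Z w <= x%:E])%E].

End empirical.

(* L^1(R) through representatives: measurable functions with finite L^1 norm.
   Two a.e. equal functions belong to the same [L1_open] sets and have the same
   image under every bounded functional, so the Borel sets and the dual are
   those of the quotient space. *)
Notation L1 R := (LfunType (@lebesgue_measure R) (@lexx _ _ 1%E)).

HB.instance Definition _ (R : realType) := isPointed.Build (L1 R) 0.

Section L1.
Context {R : realType}.

Definition L1_norm (f : L1 R) : \bar R := 'N[lebesgue_measure]_1[EFin \o f].

Definition L1_open : set (set (L1 R)) :=
  [set U | forall f, U f ->
     exists2 e : R, 0 < e & forall g : L1 R, (L1_norm (g - f)%R < e%:E)%E -> U g].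

(* bounded, i.e. continuous *)
Definition L1_bounded_functional (l : {scalar (L1 R)}) :=
  exists C : R, forall f : L1 R, (`|l f|%:E <= C%:E * L1_norm f)%E.

End L1.

Notation L1_borel R := (g_sigma_algebraType (@L1_open R)).

(* N(0, s^2), where s = 0 gives the Dirac measure at 0; [normal_prob 0 0] would
   not, as it is the uniform law on [0, 1]. *)
Definition centered_normal {R : realType} (s : R)
    (A : set (measurableTypeR R)) : \bar R :=
  if s == 0 then \d_(0 : measurableTypeR R) A else normal_prob 0 s A.

Section random_L1.
Context {R : realType} d (T : measurableType d) (P : probability T R).

Definition sample_path (G : {RV P >-> L1_borel R}) (w : T) : L1 R := G w.

Definition L1_centered_gaussian (G : {RV P >-> L1_borel R}) :=
  forall l : {scalar (L1 R)}, L1_bounded_functional l ->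
    measurable_fun [set: T] (fun w => l (sample_path G w) : measurableTypeR R) /\
    exists s : R, forall A : set (measurableTypeR R), measurable A ->
      P [set w | A (l (sample_path G w))] = centered_normal s A.

Definition L1_independent (G H : {RV P >-> L1_borel R}) :=
  forall A B : set (L1_borel R), measurable A -> measurable B ->
    P (G @^-1` A `&` H @^-1` B) = (P (G @^-1` A) * P (H @^-1` B))%E.

Definition L1_identically_distributed (G H : {RV P >-> L1_borel R}) :=
  forall A : set (L1_borel R), measurable A ->
    distribution P G A = distribution P H A.

Definition pairing (f : R -> R) (G : {RV P >-> L1_borel R}) (w : T) : R :=
  \int[lebesgue_measure]_t (f t * sample_path G w t).

Definition Zstat (G H : {RV P >-> L1_borel R}) (w : T) : \bar R :=
  (\int[lebesgue_measure]_t `|sample_path G w t - sample_path H w t|%:E)%E.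

End random_L1.

Section long_run_covariance.
Context {R : realType} d (T : measurableType d) (P : probability T R).
Variable X : int -> {RV P >-> measurableTypeR R}.

Definition strictly_stationary :=
  forall (n : nat) (k : 'I_n -> int) (h : int)
         (A : set (n.-tuple (measurableTypeR R))), measurable A ->
    P [set w | A [tuple X (k i + h) w | i < n]] =
    P [set w | A [tuple X (k i) w | i < n]].

Definition marginal_cdf (t : R) : R := fine (P [set w | X 0 w <= t]).

Definition covariance_term (f g : R -> R) (k : int) : \bar R :=
  (\int[P]_w \int[lebesgue_measure \x lebesgue_measure]_z
     (f z.1 * g z.2 * ((X 0 w <= z.1)%R%:R - marginal_cdf z.1)
                    * ((X k w <= z.2)%R%:R - marginal_cdf z.2))%:E)%E.

End long_run_covariance.

(* [s] is the sum of the bilateral series of the [a k], both of whose halves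
   are required to converge to a finite sum. *)
Definition bilateral_sum {R : realType} (a : int -> \bar R) (s : \bar R) :=
  exists l1 l2 : R,
    [/\ (\sum_(0 <= k < n) a k%:Z)%E @[n --> \oo] --> l1%:E,
        (\sum_(0 <= k < n) a (- k.+1%:Z)%R)%E @[n --> \oo] --> l2%:E
      & s = (l1 + l2)%:E].

Definition has_long_run_covariance {R : realType}
    d (T : measurableType d) (P : probability T R)
    d0 (T0 : measurableType d0) (P0 : probability T0 R)
    (X : int -> {RV P0 >-> measurableTypeR R}) (G : {RV P >-> L1_borel R}) :=
  forall f g : R -> R,
    measurable_fun [set: R] f -> measurable_fun [set: R] g ->
    (exists M, forall t, `|f t| <= M) -> (exists M, forall t, `|g t| <= M) ->
    bilateral_sum (covariance_term X f g)
      (covariance P (pairing f G) (pairing g G)).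

(* Main.v *)
(* Any coupling of two uniform measures on n atoms costs at least the L^1
   distance of their tail functions, by |x - y| = int |1{t < x} - 1{t < y}| dt
   and Tonelli; pairing the sorted atoms attains this bound, because the
   indicators of two sorted lists are nested. Hence W1 between the empirical
   measures is the integral of the tail gap, so the statistic is measurable by
   Tonelli, and it is the mean distance of the sorted atoms, so it dominates
   K^-1 |mean f(X) - mean f(Y)| for every K-Lipschitz f. Since W1 mui muj > 0,
   some bounded Lipschitz ramp has different integrals under mui and muj; thus
   almost surely T_n grows at least like c sqrt n and eventually exceeds the
   quantile, whose value is irrelevant. Dominated convergence concludes. *)
Require Import Defs.
From HB Require Import structures.
From mathcomp Require Import all_boot all_order all_algebra.
From mathcomp Require Import all_classical all_reals all_analysis.
From mathcomp Require Import measurable_realfun ring lra.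

Set Implicit Arguments.
Unset Strict Implicit.
Unset Printing Implicit Defensive.

Import Order.TTheory GRing.Theory Num.Theory.
Import numFieldNormedType.Exports.

Local Open Scope classical_set_scope.
Local Open Scope ring_scope.

(** * Threshold indicators and the layer-cake formula *)

Lemma measurable_fun_natr_lt (R : realType) d (T : measurableType d)
    (f g : T -> measurableTypeR R) :
  measurable_fun [set: T] f -> measurable_fun [set: T] g ->
  measurable_fun [set: T] (fun x => (f x < g x)%R%:R : measurableTypeR R).
Proof.
move=> mf mg; rewrite (_ : (fun x => _) = fun x => if f x < g x then 1 else 0).
  by apply: measurable_fun_ifT => //; exact: measurable_fun_ltr.
by apply/funext => x; case: ifP.
Qed.

Section layer_cake.
Context {R : realType}.
Implicit Types x y t : R.

(** The integrand is the indicator of the half-open interval between x and y, whose length is the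
    distance. *)
Lemma ereal_dist_integral x y :
  (`|x - y|%:E =
   \int[lebesgue_measure]_(t in [set: measurableTypeR R])
     `|(t < x)%R%:R - (t < y)%R%:R|%:E)%E.
Proof.
under eq_integral => t _.
  rewrite (_ : `|_ - _| = \1_(`[Num.min x y, Num.max x y[%classic : set R) t).
    over.
  rewrite indicE mem_setE in_itv/= ge_min lt_max !leNgt.
  by case: (t < x); case: (t < y) => /=;
    rewrite ?subrr ?subr0 ?sub0r ?normrN ?normr0 ?normr1.
rewrite integral_indic//= setIT lebesgue_measure_itv/= lte_fin.
have [xy|yx] := leP x y; case: ifPn => //=.
- by rewrite distrC ger0_norm// ?subr_ge0// EFinB.
- by rewrite -leNgt => yx; rewrite (@le_anti _ _ x y) ?xy// subrr normr0.
- by rewrite gtr0_norm// ?subr_gt0// EFinB.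
- by rewrite yx.
Qed.

Lemma sum_dist_natr_lt_sorted (n : nat) (s s' : seq R) t :
  sorted <=%R s -> sorted <=%R s' -> size s = n -> size s' = n ->
  \sum_(k < n) `|(t < s`_k)%R%:R - (t < s'`_k)%R%:R| =
  `|\sum_(k < n) (t < s`_k)%R%:R - \sum_(k < n) (t < s'`_k)%R%:R| :> R.
Proof.
move=> ss ss' sz sz'; rewrite -sumrB.
have mono (u : seq R) (i j : 'I_n) : sorted <=%R u -> size u = n ->
    (i <= j)%N -> u`_i <= u`_j.
  move=> su szu ij; apply: (sorted_leq_nth le_trans le_refl) => //;
  by rewrite inE szu.
(* Since both lists are sorted, all the differences have the same sign. *)
have [[i /andP[si s'i]]|noi] :=
    pselect (exists i : 'I_n, (t < s`_i) && (s'`_i <= t)).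
(* An index i with s'_i <= t < s_i excludes any j with s_j <= t < s'_j: i <= j would force t < s_j,
   and j <= i would force s'_j <= t. *)
- rewrite ger0_norm ?sumr_ge0//; last first.
  + move=> j _; rewrite subr_ge0 ler_nat; case: (ltP t s`_j) => //= sj.
      by case: (_ < _).
    rewrite ltNge; have [ij|/ltnW ji] := leqP i j.
      by move: (lt_le_trans si (mono s i j ss sz ij)); rewrite ltNge sj.
    by rewrite (le_trans (mono s' j i ss' sz' ji) s'i).
  apply: eq_bigr => j _; rewrite ger0_norm// subr_ge0 ler_nat.
  case: (ltP t s`_j) => //= sj; first by case: (_ < _).
  rewrite ltNge; have [ij|/ltnW ji] := leqP i j.
    by move: (lt_le_trans si (mono s i j ss sz ij)); rewrite ltNge sj.
  by rewrite (le_trans (mono s' j i ss' sz' ji) s'i).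
- have H (j : 'I_n) : (t < s`_j)%R%:R - (t < s'`_j)%R%:R <= 0 :> R.
    rewrite subr_le0 ler_nat; case: (ltP t s'`_j) => s'j.
      by case: (_ < _).
    case: (ltP t s`_j) => // sj; exfalso; apply: noi; exists j.
    by rewrite sj s'j.
  rewrite ler0_norm ?sumr_le0// -sumrN.
  by apply: eq_bigr => j _; rewrite ler0_norm.
Qed.

End layer_cake.

(** * Uniform measures on finitely many atoms *)

Section uniform_atoms.
Context d (T : measurableType d) {R : realType}.

(** Same body as [empirical] at a fixed outcome, but over any measurable space, so that atoms in the
    plane, hence couplings, are covered too. *)
Definition uniform_atoms (z : nat -> T) (n : nat) : {measure set T -> \bar R} :=
  mscale (n%:R^-1)%:nng (msum (fun k => \d_(z k)) n).

Lemma uniform_atomsE z n (A : set T) :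
  uniform_atoms z n A = (n%:R^-1 * \sum_(k < n) (z k \in A)%:R)%:E.
Proof.
by rewrite /uniform_atoms/= /mscale/= /msum EFinM -sumEFin.
Qed.

Lemma ge0_integral_uniform_atoms z n (f : T -> R) :
  measurable_fun [set: T] f -> (forall x, 0 <= f x) ->
  (\int[uniform_atoms z n]_x (f x)%:E)%E =
  (n%:R^-1 * \sum_(k < n) f (z k))%:E.
Proof.
move=> /measurable_EFinP mf f0; rewrite ge0_integral_mscale//=; last first.
  by move=> x _; rewrite lee_fin.
rewrite ge0_integral_measure_sum//; last by move=> x _; rewrite lee_fin.
rewrite EFinM -sumEFin; congr (_ * _)%E; apply: eq_bigr => k _.
by rewrite integral_dirac// diracT mul1e.
Qed.

End uniform_atoms.

(** * Closed form of W1 between uniform atomic measures *)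

Section wasserstein_atoms.
Context {R : realType}.
Notation RR := (measurableTypeR R).
Implicit Types x y : nat -> RR.

(** For [0 < n], the absolute difference at t of the two empirical distribution functions, expressed
    through upper tails. *)
Definition tail_gap x y (n : nat) (t : R) : R :=
  n%:R^-1 * `|\sum_(k < n) (t < x k)%R%:R - \sum_(k < n) (t < y k)%R%:R|.

Lemma coupling_setT x y n (pi : {measure set (RR * RR) -> \bar R}) :
  (0 < n)%N -> coupling (uniform_atoms x n) (uniform_atoms y n) pi ->
  pi setT = 1%E.
Proof.
move=> n0 /(_ setT measurableT)[+ _]; rewrite setXTT => ->.
rewrite uniform_atomsE; under eq_bigr do rewrite in_setT.
by rewrite sumr_const card_ord mulVf// pnatr_eq0 -lt0n.
Qed.

Lemma measurable_natr_lt_l t :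
  measurable_fun [set: RR] (fun u => (t < u)%R%:R : RR).
Proof. exact: measurable_fun_natr_lt. Qed.

(** Both tail masses are [pi]-masses of strips in the plane, so the gap is the absolute value of the
    integral of a difference of indicators. *)
Lemma tail_gap_le_coupling x y n (pi : {finite_measure set (RR * RR)%type -> \bar R}) t :
  (0 < n)%N -> coupling (uniform_atoms x n) (uniform_atoms y n) pi ->
  ((tail_gap x y n t)%:E <=
   \int[pi]_z `|(t < z.1)%R%:R - (t < z.2)%R%:R|%:E)%E.
Proof.
move=> n0 cpi; have pi1 := coupling_setT n0 cpi.
have mA : measurable (`]t, +oo[%classic : set RR) by exact: measurable_itv.
have [c1 c2] := cpi _ mA.
have tailE u : (t < u)%R%:R = \1_(`]t, +oo[%classic : set RR) u :> R.
  by rewrite indicE mem_setE in_itv/= andbT.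
have gap : ((tail_gap x y n t)%:E = `|pi (`]t, +oo[%classic `*` setT)
                                     - pi (setT `*` `]t, +oo[%classic)|)%E.
  rewrite c1 c2 !uniform_atomsE -EFinB -mulrBr abse_EFin normrM.
  rewrite ger0_norm ?invr_ge0// /tail_gap; congr (_ * `|_ - _|)%:E;
    by apply: eq_bigr => k _; rewrite tailE indicE.
have mf1 := measurableT_comp (measurable_natr_lt_l t) (@measurable_fst _ _ RR RR).
have mf2 := measurableT_comp (measurable_natr_lt_l t) (@measurable_snd _ _ RR RR).
have mX1 : measurable ((`]t, +oo[%classic : set RR) `*` (setT : set RR)).
  exact: measurableX.
have mX2 : measurable ((setT : set RR) `*` (`]t, +oo[%classic : set RR)).
  exact: measurableX.
have E1 z : (t < z.1)%R%:R =
    \1_((`]t, +oo[%classic : set RR) `*` (setT : set RR)) z :> R.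
  by rewrite tailE !indicE in_setX in_setT andbT.
have E2 z : (t < z.2)%R%:R =
    \1_((setT : set RR) `*` (`]t, +oo[%classic : set RR)) z :> R.
  by rewrite tailE !indicE in_setX in_setT.
rewrite gap -[pi (_ `*` setT)](_ : \int[pi]_z ((t < z.1)%R%:R)%:E = _)%E; last first.
  by under eq_integral do rewrite E1; rewrite integral_indic// setIT.
rewrite -[pi (setT `*` _)](_ : \int[pi]_z ((t < z.2)%R%:R)%:E = _)%E; last first.
  by under eq_integral do rewrite E2; rewrite integral_indic// setIT.
rewrite -integralB//.
- apply: (le_trans (le_abse_integral pi measurableT _)).
    apply/measurable_EFinP; exact: measurable_funB.
  exact: lexx.
- under eq_fun do rewrite E1; exact: integrable_indic.
- under eq_fun do rewrite E2; exact: integrable_indic.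
Qed.

(** Layer cake inside the cost and Tonelli bring the integral over t outside; the bound then holds
    level by level. *)
Lemma coupling_cost_ge x y n (pi : {measure set (RR * RR) -> \bar R}) :
  (0 < n)%N -> coupling (uniform_atoms x n) (uniform_atoms y n) pi ->
  (\int[lebesgue_measure]_(t in [set: RR]) (tail_gap x y n t)%:E <=
   \int[pi]_z `|z.1 - z.2|%:E)%E.
Proof.
move=> n0 cpi.
have pioo : (pi setT < +oo)%E by rewrite (coupling_setT n0 cpi) ltry.
(* A copy of [pi] carrying the finite measure structure that Tonelli needs. *)
pose pif : {finite_measure set (RR * RR)%type -> \bar R} := mfrestr measurableT pioo.
have pifE A : pif A = pi A by rewrite /pif/= /mfrestr /mrestr setIT.
have cpif : coupling (uniform_atoms x n) (uniform_atoms y n) pif.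
  by move=> A /cpi[c1 c2]; split; [exact: etrans (pifE _) c1|exact: etrans (pifE _) c2].
have mf : measurable_fun [set: (RR * RR) * RR]
    (fun p : (RR * RR) * RR => `|(p.2 < p.1.1)%R%:R - (p.2 < p.1.2)%R%:R|%:E : \bar R).
  apply/measurable_EFinP; apply: measurableT_comp => //.
  apply: measurable_funB; apply: measurable_fun_natr_lt => //.
    exact: measurableT_comp measurable_fst measurable_fst.
  exact: measurableT_comp measurable_snd measurable_fst.
under [leRHS]eq_integral do rewrite ereal_dist_integral.
rewrite (eq_measure_integral pif); last first.
  move=> A _ _;
exact: (esym (pifE A)).
have f0 (p : (RR * RR) * RR) :
  (0 <= `|(p.2 < p.1.1)%R%:R - (p.2 < p.1.2)%R%:R|%:E :> \bar R)%E.
  by rewrite lee_fin.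
have -> := @fubini_tonelli _ _ _ _ _ pif lebesgue_measure _ mf f0.
apply: ge0_le_integral => //=.
- by move=> t _; rewrite lee_fin /tail_gap mulr_ge0 ?invr_ge0.
- apply/measurable_EFinP; apply: measurable_funM => //.
  apply: measurableT_comp => //; apply: measurable_funB;
  by apply: measurable_sum => k; exact: measurable_fun_natr_lt.
- exact: (measurable_fun_fubini_tonelli_G (m1 := pif) _ mf f0).
by move=> t _; apply: tail_gap_le_coupling.
Qed.

Definition sorted_atoms x (n k : nat) : R := (sort <=%R (mkseq x n))`_k.

Lemma sum_sorted_atoms x n (f : R -> R) :
  \sum_(k < n) f (x k) = \sum_(k < n) f (sorted_atoms x n k).
Proof.
rewrite -(big_mkord xpredT (fun k => f (x k))).
rewrite -(big_mkord xpredT (fun k => f (sorted_atoms x n k))).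
transitivity (\sum_(u <- sort <=%R (mkseq x n)) f u).
  rewrite (perm_big (mkseq x n)) ?perm_sort//= big_map.
  by rewrite /index_iota subn0.
by rewrite (big_nth 0) size_sort size_mkseq.
Qed.

Lemma tail_gap_sorted x y n t :
  tail_gap x y n t =
  n%:R^-1 * \sum_(k < n) `|(t < sorted_atoms x n k)%R%:R -
                           (t < sorted_atoms y n k)%R%:R|.
Proof.
rewrite sum_dist_natr_lt_sorted ?size_sort ?size_mkseq//;
  do ?exact: sort_sorted le_total _.
rewrite /tail_gap (sum_sorted_atoms x n (fun u => (t < u)%R%:R)).
by rewrite (sum_sorted_atoms y n (fun u => (t < u)%R%:R)).
Qed.

(** Once the atoms are sorted, the absolute value passes inside the sum, and each term integrates to
    a distance by layer cake. *)
Lemma integral_tail_gap x y n :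
  (\int[lebesgue_measure]_(t in [set: RR]) (tail_gap x y n t)%:E)%E =
  (n%:R^-1 * \sum_(k < n) `|sorted_atoms x n k - sorted_atoms y n k|)%:E.
Proof.
have mk k : measurable_fun [set: RR] (fun t =>
    `|(t < sorted_atoms x n k)%R%:R - (t < sorted_atoms y n k)%R%:R| : R).
  by apply: measurableT_comp => //; apply: measurable_funB;
    exact: measurable_fun_natr_lt.
under eq_integral do rewrite tail_gap_sorted EFinM -sumEFin.
rewrite ge0_integralZl_EFin//; last 2 first.
- by move=> t _; apply: sume_ge0 => k _; rewrite lee_fin.
- by apply: emeasurable_sum => k; exact/measurable_EFinP.
rewrite ge0_integral_sum//; last by move=> k; exact/measurable_EFinP.
by under eq_bigr do rewrite -ereal_dist_integral; rewrite sumEFin -EFinM.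
Qed.

(** This is the monotone coupling. Its marginals are right because sorting only permutes the
    atoms. *)
Lemma sorted_coupling x y n :
  coupling (uniform_atoms x n) (uniform_atoms y n)
    (uniform_atoms (fun k => (sorted_atoms x n k, sorted_atoms y n k) : RR * RR) n).
Proof.
move=> A mA; rewrite !uniform_atomsE.
rewrite (sum_sorted_atoms x n (fun u => (u \in A)%:R)).
rewrite (sum_sorted_atoms y n (fun u => (u \in A)%:R)).
split; congr (_ * _)%:E; apply: eq_bigr => k _;
by rewrite in_setX in_setT ?andbT.
Qed.

Lemma W1_uniform_atoms x y n : (0 < n)%N ->
  W1 (uniform_atoms x n) (uniform_atoms y n) =
  (n%:R^-1 * \sum_(k < n) `|sorted_atoms x n k - sorted_atoms y n k|)%:E.
Proof.
move=> n0; apply/eqP; rewrite eq_le; apply/andP; split; last first.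
  rewrite -integral_tail_gap; apply/ereal_infP => _ [pi cpi <-].
  exact: coupling_cost_ge.
apply: ereal_inf_lbound; exists (uniform_atoms
    (fun k => (sorted_atoms x n k, sorted_atoms y n k) : RR * RR) n).
  exact: sorted_coupling.
rewrite (ge0_integral_uniform_atoms _ _
  (f := fun z : RR * RR => `|z.1 - z.2|))//.
by apply: measurableT_comp => //; apply: measurable_funB.
Qed.

(** The easy half of Kantorovich-Rubinstein duality, read off the closed form: means are invariant
    under sorting, so the Lipschitz bound applies pair by pair. *)
Lemma W1_uniform_atoms_lipschitz x y n (f : R -> R) (K : R) : (0 < n)%N ->
  (forall u v, `|f u - f v| <= K * `|u - v|) ->
  (`|n%:R^-1 * \sum_(k < n) f (x k) - n%:R^-1 * \sum_(k < n) f (y k)|%:E <=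
   K%:E * W1 (uniform_atoms x n) (uniform_atoms y n))%E.
Proof.
move=> n0 fK; rewrite W1_uniform_atoms// -EFinM lee_fin mulrCA -mulrBr.
rewrite normrM ger0_norm ?invr_ge0// ler_wpM2l ?invr_ge0//.
rewrite (sum_sorted_atoms x n f) (sum_sorted_atoms y n f) -sumrB mulr_sumr.
by apply: le_trans (ler_norm_sum _ _ _) _; exact: ler_sum.
Qed.

End wasserstein_atoms.

(** * Ramps: bounded Lipschitz functions that determine a measure *)

Section ramp.
Context {R : realType}.
Implicit Types t u : R.

(** For [0 < k], it climbs linearly from 0 at t to 1 at t + 1/k; for [k = 0] it vanishes. It
    approximates the indicator of []t, +oo[] from below. *)
Definition ramp t (k : nat) u : R := Num.min 1 (Num.max 0 (k%:R * (u - t))).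

Lemma ramp_ge0 t k u : 0 <= ramp t k u.
Proof. by rewrite /ramp le_min ler01/= le_max lexx. Qed.

Lemma ramp_le1 t k u : ramp t k u <= 1.
Proof. by rewrite /ramp ge_min lexx. Qed.

(** Clipping to [0, 1] contracts, so the slope k would do; [k.+1] keeps the constant positive when
    [k = 0], as division by it requires later. *)
Lemma ramp_lipschitz t k u v : `|ramp t k u - ramp t k v| <= k.+1%:R * `|u - v|.
Proof.
have -> : k.+1%:R * `|u - v| = k%:R * `|u - v| + `|u - v|.
  by rewrite -natr1 mulrDl mul1r.
have -> : k%:R * `|u - v| = `|k%:R * (u - t) - k%:R * (v - t)|.
  by rewrite -mulrBr normrM ger0_norm// opprB addrA subrK.
apply: (@le_trans _ _ `|k%:R * (u - t) - k%:R * (v - t)|); last by rewrite lerDl.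
rewrite /ramp; set a := _ * (u - t); set b := _ * (v - t).
by case: (leP 0 a) => ?; case: (leP 0 b) => ?;
  do 2?[case: (leP 1 _) => ?]; do 2?[case: (ger0P (_ - _)) => ?]; lra.
Qed.

Lemma continuous_ramp t k : continuous (ramp t k).
Proof.
move=> u; apply: (@continuous_min _ _ (cst 1) (fun v => Num.max 0 (k%:R * (v - t)))).
  exact: cvg_cst.
apply: (@continuous_max _ _ (cst 0) (fun v => k%:R * (v - t))); first exact: cvg_cst.
by apply: cvgM; [exact: cvg_cst|apply: cvgB; [exact: cvg_id|exact: cvg_cst]].
Qed.

Lemma measurable_ramp t k : measurable_fun [set: measurableTypeR R] (ramp t k).
Proof. by apply: continuous_measurable_fun; exact: continuous_ramp. Qed.

(** The sequence is eventually constant: always 0 if u <= t, and 1 as soon as k exceeds 1/(u - t)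
    otherwise. *)
Lemma cvg_ramp t u : ramp t k u @[k --> \oo] --> ((t < u)%R%:R : R).
Proof.
have [tu|ut] := ltP t u; last first.
  apply: cvg_near_cst; apply: nearW => k.
  rewrite /ramp max_l ?min_r ?ler01//.
  by rewrite mulr_ge0_le0// subr_le0.
apply: cvg_near_cst; near=> k.
have uk : 1 <= k%:R * (u - t).
  rewrite -ler_pdivrMr ?subr_gt0//; apply/ltW; near: k.
  exact: nbhs_infty_gtr.
by rewrite /ramp max_r ?min_l// (le_trans ler01).
Unshelve. all: by end_near. Qed.

Lemma cvg_integral_ramp (mu : probability (measurableTypeR R) R) t :
  (\int[mu]_u (ramp t k u)%:E)%E @[k --> \oo] --> mu `]t, +oo[%classic.
Proof.
have mA : measurable (`]t, +oo[%classic : set (measurableTypeR R)).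
  exact: measurable_itv.
have -> : mu `]t, +oo[%classic =
    (\int[mu]_u (\1_(`]t, +oo[%classic : set (measurableTypeR R)) u)%:E)%E.
  by rewrite integral_indic// setIT.
have mramp k : measurable_fun [set: measurableTypeR R] (fun u => (ramp t k u)%:E).
  by apply/measurable_EFinP; exact: measurable_ramp.
have mtail : measurable_fun [set: measurableTypeR R]
    (fun u => (\1_(`]t, +oo[%classic : set (measurableTypeR R)) u)%:E : \bar R).
  by apply/measurable_EFinP; exact: measurable_indic.
apply: (@dominated_cvg _ _ _ mu setT measurableT _ _ (cst 1%E)) => //.
- move=> u _; apply: cvg_EFin; first exact: nearW.
  by rewrite indicE mem_setE in_itv/= andbT; exact: cvg_ramp.
- exact: finite_measure_integrable_cst.
- by move=> k u _; rewrite lee_fin ger0_norm ?ramp_ge0 ?ramp_le1.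
Qed.

(** Letting k grow, ramp integrals give the masses of the open upper half-lines, an
    intersection-stable family generating the Borel sets. *)
Lemma eq_measure_ramp (mu nu : probability (measurableTypeR R) R) :
  (forall t k, (\int[mu]_u (ramp t k u)%:E = \int[nu]_u (ramp t k u)%:E)%E) ->
  forall A, measurable A -> mu A = nu A.
Proof.
move=> munu A mA.
apply: (@measure_unique _ R (measurableTypeR R) (@RGenOInfty.G R)
  (fun k => `](- k%:R), +oo[%classic) _ _ _ _ mu nu) => //.
- exact: RGenOInfty.measurableE.
- move=> _ _ [s ->] [t ->]; exists (Num.max s t).
  by apply/seteqP; split => u /=; rewrite !in_itv/= !andbT gt_max;
    [move=> [-> ->]|move=> /andP].
- by move=> k; exists (- k%:R).
- apply/seteqP; split => // u _; exists (Num.trunc `|u|).+1 => //=.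
  rewrite in_itv/= andbT ltrNl; apply: (le_lt_trans (ler_norm _)).
  by rewrite normrN truncnS_gt.
- move=> _ [t ->].
  have tailE (m : probability (measurableTypeR R) R) :
      limn (fun k => \int[m]_u (ramp t k u)%:E)%E = m `]t, +oo[%classic.
    by apply: cvg_lim => //; exact: cvg_integral_ramp.
  apply: etrans (esym (tailE mu)) _; apply: etrans (tailE nu).
  by under eq_fun do rewrite munu.
- by move=> k; rewrite (le_lt_trans (probability_le1 _ _))// ltry.
Qed.

End ramp.

(** The image of [mu] under the diagonal map is a coupling of cost 0. *)
Lemma W1_eq0 {R : realType} (mu nu : probability (measurableTypeR R) R) :
  (forall A, measurable A -> mu A = nu A) -> W1 mu nu = 0%E.
Proof.
move=> munu; pose dg (u : measurableTypeR R) := (u, u).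
have mdg : measurable_fun [set: measurableTypeR R] dg.
  by apply: measurable_fun_pair.
apply/eqP; rewrite eq_le; apply/andP; split; last first.
  by apply/ereal_infP => _ [pi _ <-]; apply: integral_ge0.
pose pi : {measure set (measurableTypeR R * measurableTypeR R)%type -> \bar R} :=
  pushforward mu dg.
apply: ereal_inf_lbound; exists (pi mdg).
  move=> A mA; rewrite /pi/= /pushforward.
  by split; [|apply: etrans (munu A mA)]; congr (mu _); apply/seteqP; split => u //= [].
rewrite ge0_integral_pushforward//.
  by apply: integral0_eq => u _ /=; rewrite subrr normr0.
apply/measurable_EFinP; apply: measurableT_comp => //; exact: measurable_funB.
Qed.

(** * Divergence of the scaled distance along one pair of trajectories *)

Section scaled_distance.
Context {R : realType}.
Notation RR := (measurableTypeR R).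

Lemma scaled_W1_gt_near (x y : nat -> RR) (f : R -> R) (K a b q : R) : 0 < K ->
  (forall u v, `|f u - f v| <= K * `|u - v|) ->
  n%:R^-1 * (\sum_(k < n) f (x k)) @[n --> \oo] --> a ->
  n%:R^-1 * (\sum_(k < n) f (y k)) @[n --> \oo] --> b ->
  a != b ->
  \forall n \near \oo, (q%:E < (Num.sqrt n%:R)%:E *
    W1 (uniform_atoms x n) (uniform_atoms y n))%E.
Proof.
move=> K0 fK xa yb ab; have ab0 : 0 < `|a - b| by rewrite normr_gt0 subr_eq0.
have ab2 : 0 < `|a - b| / 2 by rewrite divr_gt0.
have /cvgrPdist_lt /(_ _ ab2) near_ab :
    `|n%:R^-1 * (\sum_(k < n) f (x k)) - n%:R^-1 * (\sum_(k < n) f (y k))|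
    @[n --> \oo] --> `|a - b|.
  by apply: cvg_norm; exact: cvgB.
(* Chosen so that [M] times [|a - b| / 2 / K], the eventual lower bound on W1, is exactly [|q|]. *)
pose M := K * (`|a - b| / 2)^-1 * `|q|.
near=> n.
have n0 : (0 < n)%N by near: n; exists 1%N.
have sqrtM : M < Num.sqrt n%:R.
  rewrite (@le_lt_trans _ _ `|M|) ?ler_norm// -sqrtr_sqr ltr_sqrt ?ltr0n//.
  by near: n; exact: nbhs_infty_gtr.
have abn : `|a - b| / 2 <
    `|n%:R^-1 * (\sum_(k < n) f (x k)) - n%:R^-1 * (\sum_(k < n) f (y k))|.
  have : `| `|a - b| - `|n%:R^-1 * (\sum_(k < n) f (x k))
      - n%:R^-1 * (\sum_(k < n) f (y k))| | < `|a - b| / 2 by near: n.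
  by rewrite ltr_norml => /andP[_]; lra.
have := W1_uniform_atoms_lipschitz x y n0 fK.
rewrite W1_uniform_atoms// -!EFinM lee_fin lte_fin.
move=> /(lt_le_trans abn) {abn}; set D := n%:R^-1 * _ => KD.
apply: (le_lt_trans (ler_norm q)).
have -> : `|q| = M * (`|a - b| / 2 / K) by rewrite /M; field; rewrite !gt_eqF.
have D0 : `|a - b| / 2 / K < D by rewrite ltr_pdivrMr// [D * K]mulrC.
(* [M] is 0 when [q = 0], so strictness comes from [M < Num.sqrt n%:R] and [0 < D]. *)
rewrite (@le_lt_trans _ _ (M * D))//.
  by rewrite ler_wpM2l ?(ltW D0)// /M !mulr_ge0 ?invr_ge0 ?mulr_ge0 ?(ltW K0).
by rewrite ltr_pM2r// (lt_trans _ D0)// !divr_gt0.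
Unshelve. all: by end_near. Qed.

Lemma integral_ramp_fin_num (mu : probability RR R) t k :
  (\int[mu]_u (ramp t k u)%:E)%E \is a fin_num.
Proof.
rewrite ge0_fin_numE; last first.
  by apply: integral_ge0 => u _; rewrite lee_fin ramp_ge0.
rewrite (@le_lt_trans _ _ (\int[mu]_u (cst 1%E u))%E)//.
  apply: ge0_le_integral => //=.
  - by move=> u _; rewrite lee_fin ramp_ge0.
  - by apply/measurable_EFinP; exact: measurable_ramp.
  - by move=> u _; rewrite lee_fin ramp_le1.
rewrite integral_cst// mul1e.
by apply: (le_lt_trans (probability_le1 mu measurableT)); rewrite ltry.
Qed.

Lemma weakly_cvg_uniform_atoms (z : nat -> RR) (mu : probability RR R) t k :
  weakly_cvg (uniform_atoms z) mu ->
  n%:R^-1 * (\sum_(i < n) ramp t k (z i)) @[n --> \oo] -->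
  fine (\int[mu]_u (ramp t k u)%:E)%E.
Proof.
move=> /(_ (ramp t k) (@continuous_ramp _ t k)) H.
rewrite (_ : (fun n => _) =
    fine \o (fun n => \int[uniform_atoms z n]_u (ramp t k u)%:E)%E); last first.
  apply/funext => n /=; rewrite ge0_integral_uniform_atoms//.
    exact: measurable_ramp.
  exact: ramp_ge0.
apply: fine_cvg; rewrite fineK ?integral_ramp_fin_num//.
by apply: H; exists 1 => u; rewrite ger0_norm ?ramp_ge0 ?ramp_le1.
Qed.

(** Otherwise all ramp integrals agree, so the measures coincide and the diagonal coupling makes W1
    zero. *)
Lemma exists_separating_ramp (mu nu : probability RR R) : (0 < W1 mu nu)%E ->
  exists t k, fine (\int[mu]_u (ramp t k u)%:E)%E !=
              fine (\int[nu]_u (ramp t k u)%:E)%E.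
Proof.
move=> W0; apply: contrapT => nosep.
suff /W1_eq0 W1E : forall A, measurable A -> mu A = nu A by rewrite W1E ltxx in W0.
apply: eq_measure_ramp => t k.
rewrite -[LHS]fineK ?integral_ramp_fin_num// -[RHS]fineK ?integral_ramp_fin_num//.
by congr EFin; apply: contrapT => /eqP neq; apply: nosep; exists t, k.
Qed.

End scaled_distance.

(** * Measurability of the statistic, and from almost sure events to probabilities *)

Section statistic.
Context {R : realType} d (T : measurableType d) (P : probability T R).
Variables X Y : nat -> {RV P >-> measurableTypeR R}.

(** An infimum over couplings is not visibly measurable in w; the integral over t of a jointly
    measurable tail gap is, by Tonelli. *)
Lemma measurable_Tstat n : (0 < n)%N -> measurable_fun [set: T] (Tstat X Y n).
Proof.
move=> n0; rewrite (_ : Tstat X Y n = fun w => ((Num.sqrt n%:R)%:E *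
  \int[lebesgue_measure]_(t in [set: measurableTypeR R])
     (tail_gap (X^~ w) (Y^~ w) n t)%:E)%E); last first.
  by apply/funext => w; rewrite integral_tail_gap -W1_uniform_atoms.
apply: measurable_funeM.
apply: (@measurable_fun_fubini_tonelli_F _ _ T (measurableTypeR R) R
  lebesgue_measure (fun p => (tail_gap (X^~ p.1) (Y^~ p.1) n p.2)%:E)).
  apply/measurable_EFinP; apply: measurable_funM => //.
  apply: measurableT_comp => //; apply: measurable_funB;
    apply: measurable_sum => k; apply: measurable_fun_natr_lt => //;
    exact: measurableT_comp.
by move=> p; rewrite lee_fin mulr_ge0 ?invr_ge0.
Qed.

(** The indicators tend to 1 almost everywhere and are dominated by 1. *)
Lemma cvg_probability_near_event (A : nat -> set T) :
  (forall n, (0 < n)%N -> measurable (A n)) ->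
  {ae P, forall w, \forall n \near \oo, A n w} ->
  P (A n) @[n --> \oo] --> 1%E.
Proof.
(* The shift avoids [A 0], whose measurability is not assumed. *)
move=> mA nearA; rewrite -(cvg_shiftS (fun n => P (A n))).
have -> : (fun n => P (A n.+1)) = (fun n => \int[P]_w (\1_(A n.+1) w)%:E)%E.
  by apply/funext => n; rewrite integral_indic ?setIT//; exact: mA.
have mind n : measurable_fun [set: T] (fun w => (\1_(A n.+1) w)%:E : \bar R).
  by apply/measurable_EFinP; apply: measurable_indic; exact: mA.
have ind_cvg : {ae P, forall w, [set: T] w ->
    (\1_(A n.+1) w)%:E @[n --> \oo] --> cst (1%E : \bar R) w}.
  apply: filterS nearA => w [N _ wA] _; apply: cvg_near_cst.
  exists N => // n Nn; rewrite /= indicE mem_set//; apply: wA.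
  exact: leqW.
have ind_le1 : {ae P, forall w n, [set: T] w ->
    (`|(\1_(A n.+1) w)%:E| <= cst (1%E : \bar R) w)%E}.
  by apply: aeW => w n _; rewrite /= lee_fin indicE ger0_norm// lern1 leq_b1.
have P1 : (\int[P]_w cst 1 w)%E = 1%E :> \bar R.
  by rewrite integral_cst// mul1e; exact: probability_setT.
have [_ _] := dominated_convergence measurableT mind (measurable_cst _) ind_cvg
  (finite_measure_integrable_cst P 1 measurableT) ind_le1.
by rewrite P1.
Qed.

End statistic.

Theorem proposition5 (R : realType)
  (* the observed trajectories *)
  (d : measure_display) (T : measurableType d) (P : probability T R)
  (Xi Xj : nat -> {RV P >-> measurableTypeR R})
  (* the null limit processes *)
  (d' : measure_display) (T' : measurableType d') (Q : probability T' R)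
  (Gi Gj : {RV Q >-> L1_borel R})
  (* the stationary reference sequence *)
  (d0 : measure_display) (T0 : measurableType d0) (P0 : probability T0 R)
  (X0 : int -> {RV P0 >-> measurableTypeR R})
  (alpha : R)
  (mui muj : probability (measurableTypeR R) R) :
  0 < alpha < 1 ->
  strictly_stationary X0 ->
  L1_independent Gi Gj ->
  L1_identically_distributed Gi Gj ->
  L1_centered_gaussian Gi ->
  L1_centered_gaussian Gj ->
  has_long_run_covariance X0 Gi ->
  has_long_run_covariance X0 Gj ->
  mui <> muj ->
  (0 < W1 mui muj)%E ->
  {ae P, forall w, weakly_cvg (fun n => empirical Xi n w) mui} ->
  {ae P, forall w, weakly_cvg (fun n => empirical Xj n w) muj} ->
  P [set w | ((quantile Q (Zstat Gi Gj) (1 - alpha))%:E < Tstat Xi Xj n w)%E]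
    @[n --> \oo] --> 1%:E.
Proof.
move=> _ _ _ _ _ _ _ _ _ W0 cvgi cvgj.
(* The ramp depends only on the two limits, so one choice of t and k serves almost every outcome. *)
have [t [k sep]] := exists_separating_ramp W0.
apply: cvg_probability_near_event.
  move=> n n0; rewrite -[X in measurable X]setTI.
  by apply: emeasurable_fun_o_infty => //; exact: measurable_Tstat.
apply: filterS2 cvgi cvgj => w wi wj.
apply: (@scaled_W1_gt_near _ _ _ (ramp t k) k.+1%:R) sep => //.
- exact: ramp_lipschitz.
- exact: weakly_cvg_uniform_atoms wi.
- exact: weakly_cvg_uniform_atoms wj.
Qed.
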